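(* Let $W$ be the infinitely iterated permutational wreath product of copies of $\mathrm{Alt}(5)$, each in its natural action on $5$ points. There are continuously many (i.e. $2^{\aleph_0}$) pairwise non-isomorphic $4$-generator residually finite groups $\Gamma$ all having $W$ as their profinite completion, i.e. such that $\widehat{\Gamma}\cong W$.
   Context: Define finite permutation groups recursively: $W_0=\mathrm{Alt}(5)$ acting naturally on $5$ points, and, for $n\ge 0$, $W_{n+1}=\mathrm{Alt}(5)\wr W_n=\mathrm{Alt}(5)^{(5^{n+1})}\rtimes W_n$, the permutational wreath product in which $W_n$ permutes the $5^{n+1}$ direct factors according to its action on $5^{n+1}$ points, and where $W_{n+1}$ acts on $5^{n+2}$ points by the usual imprimitive action. Thus $W_n$ acts on the finite rooted tree with $n+1$ levels below the root, in which every vertex that is not a leaf has $5$ children. The iterated wreath product is the profinite group $W=\varprojlim W_n$, with respect to the natural projections $W_{n+1}\to W_n$; it is a closed subgroup of the automorphism group of the infinite $5$-regular rooted tree (each vertex having $5$ children). $\widehat{\Gamma}$ denotes the profinite completion of $\Gamma$. A group is ''$4$-generator'' if it can be generated by $4$ elements. *)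

(* Defs.v *)
(* Permutations compose from left to right: (s * t) x = t (s x). *)
From HB Require Import structures.
From mathcomp Require Import all_boot all_fingroup all_solvable.
From mathcomp Require Import generic_quotient.
From mathcomp Require Import boolp classical_sets functions cardinality.
From mathcomp Require Import topology.

Set Implicit Arguments.
Unset Strict Implicit.
Unset Printing Implicit Defensive.

Local Open Scope group_scope.

Notation group_hom := UMagmaMorphism.type (only parsing).

Lemma morph_mulg_divg (G H : groupType) (f : G -> H) :
  {morph f : x y / x * y} -> {morph f : x y / x * y^-1}.
Proof. by move=> fM x y; apply: (mulIg (f y)); rewrite -fM !mulgVK. Qed.

Section Wreath.
Local Open Scope set_scope.
Variables (X Y : finType).
Implicit Types (f g : {ffun X -> {perm Y}}) (s t : {perm X}).

Definition wr_fun f s (z : X * Y) : X * Y := (s z.1, f z.1 z.2).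

Lemma wr_fun_inj f s : injective (wr_fun f s).
Proof. by move=> [x y] [x' y'] [/perm_inj <- /perm_inj <-]. Qed.

Definition wr_perm f s : {perm X * Y} := perm (@wr_fun_inj f s).

Lemma wr_permE f s x y : wr_perm f s (x, y) = (s x, f x y).
Proof. by rewrite permE. Qed.

Lemma wr_permM f g s t :
  wr_perm f s * wr_perm g t = wr_perm [ffun x => f x * g (s x)] (s * t).
Proof. by apply/permP=> -[x y]; rewrite permM !wr_permE ffunE !permM. Qed.

Lemma wr_perm1 : wr_perm [ffun=> 1] 1 = 1.
Proof. by apply/permP=> -[x y]; rewrite wr_permE ffunE !perm1. Qed.

(* The permutational wreath product of A and H in its imprimitive action on
   X * Y: the point (x, y) is the y-th point of the x-th block. *)
Definition wreath (A : {set {perm Y}}) (H : {set {perm X}}) :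
    {set {perm X * Y}} :=
  [set wr_perm f s | f in ffun_on (mem A), s in H].

Variables (A : {group {perm Y}}) (H : {group {perm X}}).

Lemma mem_wr_perm f s :
  (forall x, f x \in A) -> s \in H -> wr_perm f s \in wreath A H.
Proof. by move=> Af Hs; apply: imset2_f => //; apply/ffun_onP. Qed.

Lemma wreathP p :
  reflect (exists f s, [/\ forall x, f x \in A, s \in H & p = wr_perm f s])
          (p \in wreath A H).
Proof.
apply: (iffP imset2P) => [[f s /ffun_onP Af Hs ->]|[f [s [Af Hs ->]]]].
  by exists f, s.
by exists f s => //; apply/ffun_onP.
Qed.

Lemma wreath_group_set : group_set (wreath A H).
Proof.
apply/group_setP; split=> [|p q /wreathP[f [s [Af Hs ->]]]].
  by rewrite -wr_perm1; apply: mem_wr_perm => // x; rewrite ffunE.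
case/wreathP=> g [t [Ag Ht ->]]; rewrite wr_permM.
by apply: mem_wr_perm => [x|]; rewrite ?ffunE groupM.
Qed.

Canonical wreath_group := Group wreath_group_set.

(* On the wreath product this is the projection wr_perm f s |-> s, for Y
   nonempty (wr_projK); elsewhere the value is irrelevant. *)
Definition wr_proj (p : {perm X * Y}) : {perm X} :=
  odflt 1 [pick s : {perm X} | [forall z, (p z).1 == s z.1]].

Lemma wr_projK (y : Y) f s : wr_proj (wr_perm f s) = s.
Proof.
rewrite /wr_proj; case: pickP => [t /forallP Et | /(_ s)/negP[]] /=.
  by apply/permP=> x; move: (Et (x, y)); rewrite wr_permE => /eqP.
by apply/forallP=> -[x z]; rewrite wr_permE.
Qed.

Definition wr_projg (p : subg_of wreath_group) : subg_of H :=
  subg H (wr_proj (sgval p)).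

Lemma wr_projgM (y : Y) : {morph wr_projg : p q / p * q}.
Proof.
move=> [p Wp] [q Wq]; apply: val_inj; rewrite /wr_projg /=.
have /wreathP[f [s [_ Hs Ep]]] := Wp; have /wreathP[g [t [_ Ht Eq]]] := Wq.
by rewrite Ep Eq wr_permM !(wr_projK y) !subgK ?groupM.
Qed.

End Wreath.

(* The base group wreath A 1 is the direct power of A indexed by X (the
   permutations wr_perm f 1); its complement wreath 1 H permutes the blocks as
   H permutes X. *)
Lemma wreath_sdprod (X Y : finType) (A : {group {perm Y}})
    (H : {group {perm X}}) :
  wreath A 1 ><| wreath 1 H = wreath A H.
Proof.
have E1 (f : {ffun X -> {perm Y}}) : (forall x, f x \in [1 {perm Y}]%G) -> f = [ffun=> 1].
  by move=> f1; apply/ffunP=> x; rewrite ffunE; apply/set1P.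
rewrite sdprodE.
- apply/setP=> p; apply/mulsgP/wreathP.
    case=> _ _ /wreathP[f [s [Af /set1P-> ->]]] /wreathP[g [t [/E1-> Ht ->]]] ->.
    exists f, t; split=> //; rewrite wr_permM mul1g; congr (wr_perm _ _).
    by apply/ffunP=> x; rewrite !ffunE mulg1.
  case=> f [s [Af Hs ->]].
  exists (wr_perm f 1) (wr_perm [ffun=> 1] s).
  - by apply: mem_wr_perm.
  - by apply: mem_wr_perm => // x; rewrite ffunE.
  rewrite wr_permM mul1g; congr (wr_perm _ _).
  by apply/ffunP=> x; rewrite !ffunE mulg1.
- apply/fintype.subsetP=> _ /wreathP[g [t [/E1-> Ht ->]]]; rewrite inE.
  apply/fintype.subsetP=> _ /imsetP[_ /wreathP[f [s [Af /set1P-> ->]]] ->].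
  set p := wr_perm [ffun=> 1] t.
  have ->: wr_perm f 1 ^ p = wr_perm [ffun x => f (t^-1 x)] 1.
    apply: (mulgI p); rewrite mulgA mulgV mul1g !wr_permM mulg1 mul1g.
    congr (wr_perm _ _); apply/ffunP=> x.
    by rewrite !ffunE permK mulg1 mul1g.
  by apply: mem_wr_perm => // x; rewrite ffunE.
apply/trivgP; apply/fintype.subsetP=> p /setIP[/wreathP[f [s [Af /set1P-> ->]]]].
case/wreathP=> g [t [/E1-> _ /permP Efg]].
rewrite inE -wr_perm1 (_ : f = [ffun=> 1]) //; apply/ffunP=> x; apply/permP=> z.
by have:= Efg (x, z); rewrite !wr_permE !ffunE => -[].
Qed.

(* The vertices at distance n.+1 from the root: 5 ^ n.+1 points. *)
Fixpoint tree_level (n : nat) : finType :=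
  if n is m.+1 then (tree_level m * 'I_5)%type else 'I_5.

Fixpoint W_ (n : nat) : {group {perm tree_level n}} :=
  match n with
  | 0 => [group of 'Alt_('I_5)]
  | m.+1 => wreath_group [group of 'Alt_('I_5)] (W_ m)
  end.

Definition W_proj (n : nat) : subg_of (W_ n.+1) -> subg_of (W_ n) :=
  @wr_projg _ _ [group of 'Alt_('I_5)] (W_ n).

Lemma W_projM n : {morph @W_proj n : p q / p * q}.
Proof. exact: (@wr_projgM _ _ _ _ ord0). Qed.

HB.instance Definition _ n :=
  isGroupMorphism.Build (subg_of (W_ n.+1)) (subg_of (W_ n)) (@W_proj n)
    (morph_mulg_divg (@W_projM n)).

Section Groups.

Definition group_isomorphic (G H : groupType) : Prop :=
  exists f : group_hom G H, bijective f.

Definition n_generator (n : nat) (G : groupType) : Prop :=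
  exists a : 'I_n -> G, forall H : {pred G},
    group_closed H -> (forall i, a i \in H) -> forall x, x \in H.

Record normal_subgroup (G : groupType) := NormalSubgroup {
  nsub_pred :> {pred G};
  nsub_group : group_closed nsub_pred;
  nsub_normal : forall x g : G, x \in nsub_pred -> x ^ g \in nsub_pred
}.

End Groups.

Section Quotient.
Local Open Scope quotient_scope.
Variables (G : groupType) (N : normal_subgroup G).

Lemma nsub1 : 1 \in N. Proof. by have [] := nsub_group N. Qed.

Lemma nsubV x : x \in N -> x^-1 \in N.
Proof. by have [N1 NF] := nsub_group N => /(NF _ _ N1); rewrite mul1g. Qed.

Lemma nsubM x y : x \in N -> y \in N -> x * y \in N.
Proof.
by have [_ NF] := nsub_group N => Nx /nsubV/(NF _ _ Nx); rewrite invgK.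
Qed.

Definition coset_eq (x y : G) : bool := x^-1 * y \in N.

Lemma coset_eq_refl : reflexive coset_eq.
Proof. by move=> x; rewrite /coset_eq mulVg nsub1. Qed.

Lemma coset_eq_sym : symmetric coset_eq.
Proof.
by move=> x y; apply/idP/idP => /nsubV; rewrite /coset_eq invgM invgK.
Qed.

Lemma coset_eq_trans : transitive coset_eq.
Proof.
move=> y x z Nxy Nyz; rewrite /coset_eq.
by have:= nsubM Nxy Nyz; rewrite mulgA mulgK.
Qed.

Canonical coset_equiv :=
  EquivRel coset_eq coset_eq_refl coset_eq_sym coset_eq_trans.

Definition quot := {eq_quot coset_equiv}.

HB.instance Definition _ := Choice.on quot.
HB.instance Definition _ := EqQuotient.on quot.

Lemma quot_eqP (x y : G) : \pi_quot x = \pi_quot y <-> x^-1 * y \in N.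
Proof. by split=> [/eqmodP | ?]; last exact/eqmodP. Qed.

Lemma quot_ind (P : quot -> Prop) : (forall x, P (\pi_quot x)) -> forall a, P a.
Proof. by move=> Ppi a; rewrite -[a]reprK. Qed.

Definition quot_mul (a b : quot) : quot := \pi_quot (repr a * repr b).
Definition quot_one : quot := \pi_quot 1.
Definition quot_inv (a : quot) : quot := \pi_quot (repr a)^-1.

Lemma quot_repr x : x^-1 * repr (\pi_quot x) \in N.
Proof. by apply/quot_eqP; rewrite reprK. Qed.

Lemma quot_piM x y : quot_mul (\pi_quot x) (\pi_quot y) = \pi_quot (x * y).
Proof.
apply/esym/quot_eqP; rewrite invgM.
have:= nsubM (nsub_normal y (quot_repr x)) (quot_repr y).
by rewrite /conjg !mulgA mulgK.
Qed.

Lemma quot_mulA : associative quot_mul.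
Proof.
elim/quot_ind=> x; elim/quot_ind=> y; elim/quot_ind=> z.
by rewrite !quot_piM mulgA.
Qed.

Lemma quot_mul1g : left_id quot_one quot_mul.
Proof. by elim/quot_ind=> x; rewrite quot_piM mul1g. Qed.

Lemma quot_mulg1 : right_id quot_one quot_mul.
Proof. by elim/quot_ind=> x; rewrite quot_piM mulg1. Qed.

Lemma quot_mulVg : left_inverse quot_one quot_inv quot_mul.
Proof. by move=> a; rewrite -{2}[a]reprK quot_piM mulVg. Qed.

Lemma quot_mulgV : right_inverse quot_one quot_inv quot_mul.
Proof. by move=> a; rewrite -{1}[a]reprK quot_piM mulgV. Qed.

HB.instance Definition _ := isGroup.Build quot
  quot_mulA quot_mul1g quot_mulg1 quot_mulVg quot_mulgV.

Lemma quot_morph : {morph (\pi_quot : G -> quot) : x y / x * y}.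
Proof. by move=> x y; rewrite -quot_piM. Qed.

HB.instance Definition _ :=
  isGroupMorphism.Build G quot (\pi_quot) (morph_mulg_divg quot_morph).

End Quotient.

Section QuotientMap.
Local Open Scope quotient_scope.
Variables (G : groupType) (N M : normal_subgroup G) (sNM : {subset N <= M}).

(* The canonical map G/N -> G/M; the inclusion proof is an argument only so
   that the map is recognized as multiplicative. *)
Definition quot_map of {subset N <= M} : quot N -> quot M :=
  fun a => \pi_(quot M) (repr a).

Lemma quot_mapE x : quot_map sNM (\pi_(quot N) x) = \pi_(quot M) x.
Proof. by apply/esym/quot_eqP/sNM/quot_repr. Qed.

Lemma quot_mapM : {morph quot_map sNM : a b / a * b}.
Proof.
by elim/quot_ind=> x; elim/quot_ind=> y; rewrite -quot_morph !quot_mapE quot_morph.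
Qed.

HB.instance Definition _ :=
  isGroupMorphism.Build (quot N) (quot M) (quot_map sNM)
    (morph_mulg_divg quot_mapM).

End QuotientMap.

Local Open Scope classical_set_scope.

HB.mixin Record Group_isTopological G & monoid.Group G & Topological G := {
  mulg_continuous : continuous (fun xy : G * G => xy.1 * xy.2);
  invg_continuous : continuous (fun x : G => x^-1)
}.

#[short(type="topGroupType")]
HB.structure Definition TopGroup :=
  {G of monoid.Group G & Topological G & Group_isTopological G}.

Definition topGroup_isomorphic (G H : topGroupType) : Prop :=
  exists (f : group_hom G H) (g : H -> G),
    [/\ cancel f g, cancel g f, continuous f & continuous g].

Section Limit.

(* Diagrams of groups of arbitrary shape; the limit consists of the families
   compatible with all arrows, in the topology induced by the product of the
   discrete groups. *)
Record group_system := GroupSystem {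
  gs_index : Type;
  gs_group : gs_index -> groupType;
  gs_arrow : Type;
  gs_src : gs_arrow -> gs_index;
  gs_tgt : gs_arrow -> gs_index;
  gs_map : forall a,
    group_hom (gs_group (gs_src a)) (gs_group (gs_tgt a))
}.

Variable S : group_system.

Definition gs_product : topologicalType :=
  prod_topology (fun i : gs_index S => discrete_topology (gs_group i)).

Definition gs_threads : set gs_product :=
  [set x | forall a : gs_arrow S, gs_map a (x (gs_src a)) = x (gs_tgt a)].

Definition limit : Type := set_type gs_threads.

HB.instance Definition _ := Topological.on limit.

Definition limit_coord (x : limit) (i : gs_index S) : gs_group i := val x i.

Lemma limit_coordP (x : limit) a :
  gs_map a (limit_coord x (gs_src a)) = limit_coord x (gs_tgt a).
Proof. exact: (set_mem (valP x)). Qed.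

Lemma limit_inj (x y : limit) :
  (forall i, limit_coord x i = limit_coord y i) -> x = y.
Proof. by move=> exy; apply/val_inj/functional_extensionality_dep. Qed.

Definition limit_mk (x : forall i : gs_index S, gs_group i)
    (Px : forall a, gs_map a (x (gs_src a)) = x (gs_tgt a)) : limit :=
  exist _ (x : gs_product) (mem_set Px).

Definition limit_one : limit := limit_mk (x := fun=> 1) 
  (fun a => gmulf1).

Lemma limit_mul_subproof (x y : limit) a :
  gs_map a (limit_coord x (gs_src a) * limit_coord y (gs_src a)) =
  limit_coord x (gs_tgt a) * limit_coord y (gs_tgt a).
Proof. by rewrite gmulfM !limit_coordP. Qed.

Definition limit_mul (x y : limit) : limit :=
  limit_mk (x := fun i => limit_coord x i * limit_coord y i)
    (limit_mul_subproof x y).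

Lemma limit_inv_subproof (x : limit) a :
  gs_map a (limit_coord x (gs_src a))^-1 = (limit_coord x (gs_tgt a))^-1.
Proof. by rewrite gmulfV limit_coordP. Qed.

Definition limit_inv (x : limit) : limit :=
  limit_mk (x := fun i => (limit_coord x i)^-1) (limit_inv_subproof x).

Lemma limit_mulA : associative limit_mul.
Proof. by move=> x y z; apply: limit_inj => i; exact: mulgA. Qed.

Lemma limit_mul1g : left_id limit_one limit_mul.
Proof. by move=> x; apply: limit_inj => i; exact: mul1g. Qed.

Lemma limit_mulg1 : right_id limit_one limit_mul.
Proof. by move=> x; apply: limit_inj => i; exact: mulg1. Qed.

Lemma limit_mulVg : left_inverse limit_one limit_inv limit_mul.
Proof. by move=> x; apply: limit_inj => i; exact: mulVg. Qed.

Lemma limit_mulgV : right_inverse limit_one limit_inv limit_mul.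
Proof. by move=> x; apply: limit_inj => i; exact: mulgV. Qed.

HB.instance Definition _ := isGroup.Build limit
  limit_mulA limit_mul1g limit_mulg1 limit_mulVg limit_mulgV.


Lemma limit_coord_continuous i :
  continuous (fun x : limit => limit_coord x i : discrete_topology (gs_group i)).
Proof.
move=> x; apply: (@continuous_comp limit gs_product _ val (fun y => y i)).
  exact: initial_continuous.
exact: (@proj_continuous {classic gs_index S}
  (fun i => discrete_topology (gs_group i)) i).
Qed.

Lemma limit_continuous (T : topologicalType) (f : T -> limit) :
  (forall i, continuous
     (fun t => limit_coord (f t) i : discrete_topology (gs_group i))) ->
  continuous f.
Proof.
move=> fi; apply: (@continuous_comp_initial _ _ _ val f) => t.
apply/cvg_sup => i U [V [[O oO <-] Of] OU].
apply: (filterS OU); exact: (fi i t O (open_nbhs_nbhs (conj oO Of))).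
Qed.

Lemma limit_mul_continuous : continuous (fun xy : limit * limit => xy.1 * xy.2).
Proof.
apply: limit_continuous => i -[x y] U /nbhs_singleton /= Uxy.
have near_coord z : nbhs z [set z' | limit_coord z' i = limit_coord z i].
  exact: (limit_coord_continuous (discrete_set1 _)).
exists ([set z | limit_coord z i = limit_coord x i],
        [set z | limit_coord z i = limit_coord y i]) => //=.
move=> [x' y'] /= [ex ey]; rewrite /= -/(limit_mul x' y').
by rewrite /limit_mul /limit_coord /= -!/(limit_coord _ _) ex ey.
Qed.

Lemma limit_inv_continuous : continuous (fun x : limit => x^-1).
Proof.
apply: limit_continuous => i x U /nbhs_singleton /= Ux.
have: nbhs x [set z | limit_coord z i = limit_coord x i].
  exact: (limit_coord_continuous (discrete_set1 _)).
by apply: filterS => z /= ez; move: Ux; rewrite /limit_coord /= ez.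
Qed.

HB.instance Definition _ :=
  Group_isTopological.Build limit limit_mul_continuous limit_inv_continuous.

End Limit.

Section ProfiniteCompletion.
Variable G : groupType.

Definition finite_index (N : normal_subgroup G) : Prop :=
  finite_set [set: quot N].

Definition residually_finite : Prop :=
  forall x : G, x <> 1 -> exists2 N : normal_subgroup G,
    finite_index N & x \notin N.

Definition completion_system : group_system := {|
  gs_index := {N : normal_subgroup G | finite_index N};
  gs_group := fun N => quot (sval N);
  gs_arrow := {NM : {N | finite_index N} * {N | finite_index N} |
                {subset sval NM.1 <= sval NM.2}};
  gs_src := fun a => (sval a).1;
  gs_tgt := fun a => (sval a).2;
  gs_map := fun a => quot_map (proj2_sig a)
|}.

Definition profinite_completion : topGroupType := limit completion_system.

End ProfiniteCompletion.

Definition W_system : group_system := {|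
  gs_index := nat;
  gs_group := fun n => subg_of (W_ n);
  gs_arrow := nat;
  gs_src := fun n => n.+1;
  gs_tgt := fun n => n;
  gs_map := fun n => @W_proj n
|}.

Definition W : topGroupType := limit W_system.

(* Main.v *)
From HB Require Import structures.
From mathcomp Require Import all_boot all_fingroup all_solvable.
From mathcomp Require Import generic_quotient.
From mathcomp Require Import boolp classical_sets cardinality.
From mathcomp Require Import topology.
Require Import Defs.

(** W may be identified with the group of all portraits, i.e. of all families of
    elements of Alt(5) indexed by the vertices of the 5-regular rooted tree, and
    every binary sequence s gives a finitely generated dense subgroup of it, the
    spinal group of s. It is generated by two copies of Alt(5): the rooted
    elements, which permute the five subtrees below the root, and the directed
    elements
<<
      directed s a = (directed (shift s) a at child 0, rooted a at child k),
>>
    where k is 1 or 2 according to the first bit of s. As Alt(5) is generated by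
    two elements (alt5_gen2), the spinal groups are generated by four.

    Self-similarity. A rooted conjugation that fixes child 0 and moves child k
    off the support makes the commutators of directed elements live at child 0
    only, and likewise with the roles of 0 and k exchanged. Alt(5) is perfect;
    hence the spinal group G of s contains the spinal group of shift s acting
    below any given child (spinal_at_child), so that G is the wreath product of
    the spinal group of shift s with Alt(5). Density in W (spinal_dense) follows
    by induction on the level.

    Congruence property. A nontrivial normal subgroup N of G has an element p
    that moves some vertex w. For g and h acting below w, the double commutator
    of g^-1, p and h is [g, h], because g^p acts below another vertex of the
    level of w and so commutes with h. The spinal groups being perfect, N
    contains the whole copy of a spinal group below w, and below every vertex of
    that level by transitivity; these copies generate the level stabilizer
    (spinal_normal_congruence). Since G is infinite, each normal subgroup of
    finite index contains the stabilizer of some level, and the profinite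
    completion of G is the limit of its actions on the levels, which is W
    (profinite_completion_sequence, spinal_completion).

    Non-isomorphism. The first bit of s is seen in whether a fixed commutator
    of generators vanishes, and the next bits in the same way after descending
    to child 0; hence an isomorphism that respects the four generators exists
    only between the groups of equal parameters (marked_rigid). A finitely
    generated group has countably many quadruples, so each isomorphism class
    occurs for countably many s. A diagonal argument in the style of Koenig then
    selects continuum many parameters from distinct classes
    (cantor_constant_fiber, rigid_selection). *)

Set Implicit Arguments.
Unset Strict Implicit.
Unset Printing Implicit Defensive.

Local Open Scope group_scope.

(** * Subgroups of the alternating group of degree 5 *)

(** The counterpart of group_closed for predicates in Prop, which here are often
    existential statements. *)
Definition subgroup_pred (G : groupType) (P : G -> Prop) :=
  P 1 /\ forall x y, P x -> P y -> P (x * y^-1).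

Section SubgroupPred.
Variables (G : groupType) (P : G -> Prop).
Hypothesis sgP : subgroup_pred P.

Lemma subgroup_pred1 : P 1. Proof. by case: sgP. Qed.

Lemma subgroup_predV x : P x -> P x^-1.
Proof. by case: sgP => P1 PF /(PF _ _ P1); rewrite mul1g. Qed.

Lemma subgroup_predM x y : P x -> P y -> P (x * y).
Proof. by case: sgP => _ PF Px /subgroup_predV/(PF _ _ Px); rewrite invgK. Qed.

Lemma subgroup_predJ x y : P x -> P y -> P (x ^ y).
Proof.
by move=> Px Py; do 2?apply: subgroup_predM => //; apply: subgroup_predV.
Qed.

Lemma subgroup_predR x y : P x -> P y -> P [~ x, y].
Proof.
move=> Px Py; apply: subgroup_predM; first exact: subgroup_predV.
exact: subgroup_predJ.
Qed.

End SubgroupPred.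

(** The bridge from Prop-valued closure arguments to the subgroups of a finite
    group, to which simplicity and Lagrange apply. *)
Lemma subgroup_pred_set (gT : finGroupType) (G : {group gT})
    (P : subg_of G -> Prop) : subgroup_pred P ->
  exists2 H : {group gT}, H \subset G & forall a, (sgval a \in H) <-> P a.
Proof.
move=> sgP; pose H := [set sgval a | a : subg_of G & `[< P a >]].
have HP a : (sgval a \in H) <-> P a.
  split=> [/imsetP[b + /val_inj->]|Pa]; first by rewrite finset.inE => /asboolP.
  by apply/imsetP; exists a => //; rewrite finset.inE; apply/asboolP.
have gH : group_set H.
  apply/group_setP; split.
    by have /HP := subgroup_pred1 sgP.
  move=> _ _ /imsetP[a + ->] /imsetP[b + ->]; rewrite !finset.inE.
  move=> /asboolP Pa /asboolP Pb; rewrite -sgvalM ?inE //; apply/HP.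
  exact: subgroup_predM.
exists (Group gH) => //=; apply/fintype.subsetP=> _ /imsetP[a _ ->].
exact: subgP.
Qed.

Local Notation A5 := [group of 'Alt_('I_5)].

Definition alt5 : finGroupType := subg_of A5.

Definition move (a : alt5) : 'I_5 -> 'I_5 := sgval a.

Lemma move1 i : move 1 i = i. Proof. by rewrite /move perm1. Qed.

Lemma moveM a b i : move (a * b) i = move b (move a i).
Proof. by rewrite /move sgvalM ?permM. Qed.

Lemma moveK a : cancel (move a) (move a^-1).
Proof. by move=> i; rewrite -moveM mulgV move1. Qed.

Lemma moveKV a : cancel (move a^-1) (move a).
Proof. by move=> i; rewrite -moveM mulVg move1. Qed.

Lemma move_inj a : injective (move a).
Proof. exact: can_inj (moveK a). Qed.

Lemma even_alt5 (p : {perm 'I_5}) :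
  ~~ odd_perm p -> exists a : alt5, move a = p.
Proof.
move=> ep; exists (subg A5 p).
by rewrite /move subgK // Alt_even.
Qed.

(** The permutations needed are written as products of two transpositions,
    which makes their parity immediate. *)
Lemma alt5_cycle3 (i j k : 'I_5) : uniq [:: i; j; k] ->
  exists a : alt5, [/\ move a i = j, move a j = k, move a k = i
    & forall l, l \notin [:: i; j; k] -> move a l = l].
Proof.
rewrite /= !inE negb_or andbT => /andP[/andP[ij ik] jk].
have [|a Ea] := @even_alt5 (tperm i j * tperm i k).
  by rewrite odd_permM !odd_tperm ij ik.
exists a; rewrite !Ea !permM; split.
- by rewrite tpermL tpermD // eq_sym.
- by rewrite tpermR tpermL.
- by rewrite (tpermD ik jk) tpermR.
move=> l; rewrite !inE !negb_or => /and3P[li lj lk].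
by rewrite permM !tpermD // eq_sym.
Qed.

Lemma alt5_swaps (i j k l : 'I_5) : uniq [:: i; j; k; l] ->
  exists a : alt5, [/\ move a i = j, move a j = i, move a k = l, move a l = k
    & forall m, m \notin [:: i; j; k; l] -> move a m = m].
Proof.
rewrite /= !inE !negb_or andbT => /and3P[/and3P[ij ik il] /andP[jk jl] kl].
have [|a Ea] := @even_alt5 (tperm i j * tperm k l).
  by rewrite odd_permM !odd_tperm ij kl.
exists a; rewrite !Ea !permM; split.
- by rewrite tpermL tpermD // eq_sym.
- by rewrite tpermR tpermD // eq_sym.
- by rewrite (tpermD ik jk) tpermL.
- by rewrite (tpermD il jl) tpermR.
move=> m; rewrite !inE !negb_or => /and4P[mi mj mk ml].
by rewrite permM !tpermD // eq_sym.
Qed.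

Lemma alt5_transitive (i j : 'I_5) : exists a, move a i = j.
Proof.
have [<-|ij] := eqVneq i j; first by exists 1; rewrite move1.
have [k]: exists k, k \notin [:: i; j].
  apply/existsP; rewrite -negb_forall; apply/negP=> /forallP all2.
  have: (#|'I_5| <= size [:: i; j])%N.
    by apply: leq_trans (card_size _); apply/subset_leq_card/fintype.subsetP.
  by rewrite card_ord.
rewrite !inE negb_or => /andP[ki kj].
have [|a [ai _ _ _]] := @alt5_cycle3 i j k; last by exists a.
by rewrite /= !inE negb_or ij !(eq_sym _ k) ki kj.
Qed.

Lemma simple_alt5 : simple A5.
Proof. by apply: simple_Alt5; rewrite card_ord. Qed.

Lemma card_alt5 : #|A5| = 60.
Proof.
have := @card_Alt 'I_5; rewrite card_ord => /(_ isT).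
by rewrite (_ : 5`! = 2 * 60)%N // => /eqP; rewrite eqn_pmul2l // => /eqP.
Qed.

Lemma alt5_perfect (P : alt5 -> Prop) :
  subgroup_pred P -> (forall a b, P [~ a, b]) -> forall a, P a.
Proof.
move=> /subgroup_pred_set[H sHG HP] PR a; apply/HP.
set G := A5 in H sHG HP a *.
have nabG : ~~ abelian G.
  apply: contraFN (@solvable_AltF 'I_5 _); last by rewrite card_ord.
  by move/abelian_sol.
have G'G: G^`(1) = G.
  have [_ /(_ (G^`(1))%G (der_normal 1 G))[G'1|//]] := simpleP _ simple_alt5.
  by case/negP: nabG; apply/derG1P.
have sH: G^`(1) \subset H.
  rewrite gen_subG; apply/fintype.subsetP=> _ /imset2P[x y Gx Gy ->].
  rewrite -(subgK _ Gx) -(subgK _ Gy) -(morphR (sgval_morphism G)) ?inE //.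
  exact/HP/PR.
by apply: (fintype.subsetP sH); rewrite G'G subgP.
Qed.


Definition o0 : 'I_5 := @Ordinal 5 0 isT.
Definition o1 : 'I_5 := @Ordinal 5 1 isT.
Definition o2 : 'I_5 := @Ordinal 5 2 isT.
Definition o3 : 'I_5 := @Ordinal 5 3 isT.
Definition o4 : 'I_5 := @Ordinal 5 4 isT.

Lemma ord5_ind (P : 'I_5 -> Prop) :
  P o0 -> P o1 -> P o2 -> P o3 -> P o4 -> forall i, P i.
Proof.
move=> P0 P1 P2 P3 P4 [[|[|[|[|[|//]]]]] lti];
  rewrite (bool_irrelevance lti isT);
  by [exact: P0 | exact: P1 | exact: P2 | exact: P3 | exact: P4].
Qed.

Lemma alt5_order p (a : alt5) i : prime p -> move a i != i ->
  (forall j, iter p (move a) j = j) -> #[sgval a] = p.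
Proof.
move=> pr_p ai ap; apply: nt_prime_order => //.
  by apply/permP=> j; rewrite permX perm1 ap.
by apply: contraNneq ai => a1; rewrite /move a1 perm1.
Qed.

(** Elements y of order 3 and t of order 2 whose product has order 5: a subgroup
    containing them has order divisible by 30, hence index at most 2, hence is
    normal; Alt(5) is simple. *)
Lemma alt5_gen2 : exists x y : alt5, forall P : alt5 -> Prop,
  subgroup_pred P -> P x -> P y -> forall a, P a.
Proof.
have [|y [y0 y4 y2 yE]] := @alt5_cycle3 o0 o4 o2; first by [].
have [|t [t0 t1 t2 t3 tE]] := @alt5_swaps o0 o1 o2 o3; first by [].
have y1 := yE o1 isT; have y3 := yE o3 isT; have t4 := tE o4 isT.
(* y = (0 4 2) and t = (0 1)(2 3), so that z = (0 4 3 2 1). *)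
pose z := y * t.
have zE i : move z i = move t (move y i) by rewrite moveM.
exists y, t => P sgP Py Pt a.
have [H sHG HP] := subgroup_pred_set sgP; apply/HP.
suff ->: H = A5 by apply: subgP.
have dvd q (b : alt5) i : prime q -> P b -> move b i != i ->
    (forall j, iter q (move b) j = j) -> q %| #|H|.
  by move=> pr_q /HP Hb bi bq; rewrite -(alt5_order pr_q bi bq) order_dvdG.
have d3: 3 %| #|H|.
  by apply: (dvd _ y o0); rewrite ?y0 //; apply: ord5_ind;
    rewrite /= !(y0, y1, y2, y3, y4).
have d2: 2 %| #|H|.
  by apply: (dvd _ t o0); rewrite ?t0 //; apply: ord5_ind;
    rewrite /= !(t0, t1, t2, t3, t4).
have d5: 5 %| #|H|.
  apply: (dvd _ z o0); rewrite ?zE ?y0 ?t4 //; first exact: subgroup_predM.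
  by apply: ord5_ind; rewrite /= !zE !(y0,y1,y2,y3,y4,t0,t1,t2,t3,t4).
have d30: 30 %| #|H| by rewrite (@Gauss_dvd 6 5) // (@Gauss_dvd 2 3) // d2 d3.
have ntH: H :!=: 1.
  by apply/negP=> /eqP H1; move: d30; rewrite H1 cards1.
have nH: H <| A5.
  have := Lagrange sHG; rewrite card_alt5; case/dvdnP: d30 => k ->.
  rewrite mulnAC => kE.
  have {}kE : (k * #|A5 : H| = 2)%N.
    by apply/eqP; rewrite -(@eqn_pmul2r 30) // kE.
  have [idx1|idx_neq1] := eqVneq #|A5 : H| 1%N.
    have/eqP := idx1; rewrite indexg_eq1 => sGH.
    rewrite (_ : H = A5) ?normal_refl //.
    by apply/val_inj/eqP; rewrite finset.eqEsubset sHG.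
  have idx2: 1 < #|A5 : H| by rewrite ltn_neqAle eq_sym idx_neq1 indexg_gt0.
  case: k kE => [|[|k]] kE; first by rewrite mul0n in kE.
    by rewrite mul1n in kE; apply: index2_normal sHG kE.
  by have := leq_mul (isT : 1 < k.+2) idx2; rewrite kE.
have [_ /(_ H nH)[H1|/val_inj//]] := simpleP _ simple_alt5.
by rewrite H1 eqxx in ntH.
Qed.

(** * Portraits of automorphisms of the 5-regular rooted tree *)

(** The label at v is the permutation that the automorphism induces from the
    children of v to the children of the image of v. *)
Definition portrait : Type := seq 'I_5 -> alt5.

HB.instance Definition _ := gen_eqMixin portrait.
HB.instance Definition _ := gen_choiceMixin portrait.

Definition section (p : portrait) (i : 'I_5) : portrait := fun v => p (i :: v).

(** Left-to-right composition: p sends the subtree below child i to the one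
    below child [move (p [::]) i], where the action of q takes over. *)
Fixpoint portrait_mul (p q : portrait) (v : seq 'I_5) : alt5 :=
  if v is i :: w then portrait_mul (section p i) (section q (move (p [::]) i)) w
  else p [::] * q [::].

Fixpoint portrait_inv (p : portrait) (v : seq 'I_5) : alt5 :=
  if v is i :: w then portrait_inv (section p (move (p [::])^-1 i)) w
  else (p [::])^-1.

Definition portrait_one : portrait := fun=> 1.

Lemma portrait_mulA : associative portrait_mul.
Proof.
move=> p q r; apply: functional_extensionality_dep => v.
elim: v p q r => [|i v IHv] p q r /=; first by rewrite mulgA.
by rewrite moveM; exact: IHv.
Qed.

Lemma portrait_mul1g : left_id portrait_one portrait_mul.
Proof.
move=> p; apply: functional_extensionality_dep => v.
elim: v p => [|i v IHv] p /=; first by rewrite mul1g.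
by rewrite move1; exact: IHv.
Qed.

Lemma portrait_mulg1 : right_id portrait_one portrait_mul.
Proof.
move=> p; apply: functional_extensionality_dep => v.
by elim: v p => [|i v IHv] p /=; [rewrite mulg1 | exact: IHv].
Qed.

Lemma portrait_mulVg : left_inverse portrait_one portrait_inv portrait_mul.
Proof.
move=> p; apply: functional_extensionality_dep => v.
by elim: v p => [|i v IHv] p /=; [rewrite mulVg | exact: IHv].
Qed.

Lemma portrait_mulgV : right_inverse portrait_one portrait_inv portrait_mul.
Proof.
move=> p; apply: functional_extensionality_dep => v.
elim: v p => [|i v IHv] p /=; first by rewrite mulgV.
have -> :
    section (portrait_inv p) (move (p [::]) i) = portrait_inv (section p i).
  by rewrite /section /= moveK.
exact: IHv.
Qed.

HB.instance Definition _ := isGroup.Build portrait portrait_mulA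
  portrait_mul1g portrait_mulg1 portrait_mulVg portrait_mulgV.

Section Portraits.

Implicit Types (p q : portrait) (i j : 'I_5) (v w : seq 'I_5).

Lemma rootM p q : (p * q) [::] = p [::] * q [::]. Proof. by []. Qed.
Lemma rootV p : p^-1 [::] = (p [::])^-1. Proof. by []. Qed.

Lemma sectionM p q i :
  section (p * q) i = section p i * section q (move (p [::]) i).
Proof. by []. Qed.

Lemma sectionV p i : section p^-1 i = (section p (move (p [::])^-1 i))^-1.
Proof. by []. Qed.

Lemma portraitP p q :
  p [::] = q [::] -> (forall i, section p i = section q i) -> p = q.
Proof.
move=> e0 es; apply: functional_extensionality_dep => -[//|i v].
by have := congr1 (@^~ v) (es i).
Qed.

Definition node (a : alt5) (g : 'I_5 -> portrait) : portrait :=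
  fun v => if v is i :: w then g i w else a.

Lemma nodeE p : p = node (p [::]) (section p). Proof. exact: portraitP. Qed.

Lemma section_node a f i : section (node a f) i = f i. Proof. by []. Qed.

Lemma nodeM a b f g :
  node a f * node b g = node (a * b) (fun i => f i * g (move a i)).
Proof. exact: portraitP. Qed.

Lemma node1V f : (node 1 f)^-1 = node 1 (fun i => (f i)^-1).
Proof.
apply: portraitP => [|i]; rewrite ?rootV ?invg1 // sectionV /= invg1 move1.
by [].
Qed.

Lemma node1 : node 1 (fun=> 1) = 1. Proof. exact: portraitP. Qed.

Lemma node1M f g : node 1 f * node 1 g = node 1 (fun i => f i * g i).
Proof.
by rewrite nodeM mulg1; apply: portraitP => // i; rewrite /section /= move1.
Qed.

Lemma node1R f g : [~ node 1 f, node 1 g] = node 1 (fun i => [~ f i, g i]).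
Proof. by rewrite /commg /conjg !node1V !node1M. Qed.

Definition rooted (a : alt5) : portrait := node a (fun=> 1).

Lemma rootedM a b : rooted (a * b) = rooted a * rooted b.
Proof.
by rewrite /rooted nodeM; apply: portraitP => // i; exact/esym/mulg1.
Qed.

Lemma rooted1 : rooted 1 = 1. Proof. exact: node1. Qed.

Lemma rootedV a : rooted a^-1 = (rooted a)^-1.
Proof. by apply: (mulIg (rooted a)); rewrite -rootedM !mulVg rooted1. Qed.

Lemma rootedR a b : rooted [~ a, b] = [~ rooted a, rooted b].
Proof. by rewrite /commg /conjg !rootedM !rootedV. Qed.

Lemma node_rooted a f : node a f = node 1 f * rooted a.
Proof.
rewrite /rooted nodeM mul1g; apply: portraitP => // i.
by rewrite /section /= mulg1.
Qed.

Lemma node1J f a : node 1 f ^ rooted a = node 1 (fun i => f (move a^-1 i)).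
Proof.
rewrite /conjg -node_rooted -rootedV /rooted nodeM mulVg.
by apply: portraitP => // i; rewrite /section /= mul1g.
Qed.

Definition at_child (i : 'I_5) (g : portrait) : portrait :=
  node 1 (fun j => if j == i then g else 1).

Lemma at_child1 i : at_child i 1 = 1.
Proof. by apply: portraitP => // j; rewrite /section /=; case: eqP. Qed.

Lemma at_childM i : {morph at_child i : g h / g * h}.
Proof.
move=> g h; rewrite /at_child node1M; congr node; apply/funext=> j.
by case: eqP; rewrite ?mulg1.
Qed.

Lemma at_childV i : {morph at_child i : g / g^-1}.
Proof.
move=> g; rewrite /at_child node1V; congr node; apply/funext=> j.
by case: eqP; rewrite ?invg1.
Qed.

Lemma at_child_mull i g p :
  at_child i g * p = p * at_child (move (p [::]) i) (g ^ section p i).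
Proof.
apply: portraitP => [|j]; first by rewrite !rootM mul1g mulg1.
rewrite !sectionM /at_child !section_node /= move1 (inj_eq (@move_inj _)).
by case: eqP => [->|_]; rewrite ?mul1g ?mulg1 // -conjgC.
Qed.

Lemma at_childJ i g p :
  at_child i g ^ p = at_child (move (p [::]) i) (g ^ section p i).
Proof. by rewrite {1}/conjg at_child_mull mulKg. Qed.

Lemma at_child_commute i j g h :
  i != j -> commute (at_child i g) (at_child j h).
Proof.
move=> ij; rewrite /commute /at_child !node1M; congr node; apply/funext=> k.
case: (k =P i) => [->|_]; first by rewrite (negPf ij) mulg1 mul1g.
by rewrite mul1g mulg1.
Qed.

Fixpoint at_vertex (w : seq 'I_5) (g : portrait) : portrait :=
  if w is i :: u then at_child i (at_vertex u g) else g.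

Lemma at_vertexM w : {morph at_vertex w : g h / g * h}.
Proof. by elim: w => //= i w IHw g h; rewrite IHw at_childM. Qed.

Lemma at_vertexV w : {morph at_vertex w : g / g^-1}.
Proof. by elim: w => //= i w IHw g; rewrite IHw at_childV. Qed.

Lemma at_vertexR w g h :
  at_vertex w [~ g, h] = [~ at_vertex w g, at_vertex w h].
Proof. by rewrite /commg /conjg !at_vertexM !at_vertexV. Qed.

Fixpoint act (p : portrait) (v : seq 'I_5) : seq 'I_5 :=
  if v is i :: w then move (p [::]) i :: act (section p i) w else [::].

Definition sections p v : portrait := fun w => p (v ++ w).

Lemma size_act p v : size (act p v) = size v.
Proof. by elim: v p => //= i v IHv p; rewrite IHv. Qed.

Lemma act_rcons p v i : act p (rcons v i) = rcons (act p v) (move (p v) i).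
Proof. by elim: v p => //= j v IHv p; rewrite IHv. Qed.

(** The cocycle rule for labels, which [portrait_mul] encodes recursively. *)
Lemma portrait_mulE p q v : (p * q) v = p v * q (act p v).
Proof. by elim: v p q => //= i v IHv p q; exact: IHv. Qed.

Lemma at_vertexJ w g p :
  at_vertex w g ^ p = at_vertex (act p w) (g ^ sections p w).
Proof. by elim: w p => //= i w IHw p; rewrite at_childJ IHw. Qed.

Lemma at_vertex_commute v w g h :
  size v = size w -> v != w -> commute (at_vertex v g) (at_vertex w h).
Proof.
elim: v w => [|i v IHv] [|j w] //= [] svw.
rewrite eqseq_cons; have [<-|ij _] := eqVneq i j => /= [vw|].
  by rewrite /commute -!at_childM; congr at_child; exact: IHv.
exact: at_child_commute.
Qed.

Lemma act_moves p v : p v != 1 -> exists w, act p w != w.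
Proof.
move=> pv; have [i pvi]: exists i, move (p v) i != i.
  apply/existsP; rewrite -negb_forall; apply: contra pv => /forallP pv1.
  apply/eqP/val_inj/permP=> i; rewrite perm1; exact/eqP/pv1.
exists (rcons v i); rewrite act_rcons eqseq_rcons negb_and pvi orbT.
by [].
Qed.

(** As p moves w, the conjugate of [at_vertex w g^-1] by p is supported below
    another vertex of the same level, so it commutes with everything below w and
    drops out of the second commutator. *)
Lemma commg_moved w g h p : act p w != w ->
  [~ [~ at_vertex w g^-1, p], at_vertex w h] = at_vertex w [~ g, h].
Proof.
move=> pw; rewrite at_vertexR at_vertexV.
set u := at_vertex w g; set k := at_vertex w h; pose z := u^-1 ^ p.
have zC x : commute z (at_vertex w x).
  rewrite /z /u -at_vertexV at_vertexJ.
  by apply: at_vertex_commute => //; rewrite size_act.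
rewrite (commgEl u^-1) invgK -/z (commgEr (u * z)) conjgM (commgEr u).
congr (_ * k).
apply/eqP; rewrite conjg_fix commg1_sym; apply/commgP.
by rewrite /u /k /conjg -!at_vertexV -!at_vertexM.
Qed.

End Portraits.

(** * Spinal groups and their normal subgroups *)

Section SpinalGroups.

Implicit Types (p q : portrait) (i j : 'I_5) (v w : seq 'I_5).

Definition shift (s : nat -> bool) : nat -> bool := fun n => s n.+1.

(** The child besides o0 on which a directed element acts. The children o3 and
    o4 are kept free in both cases, as room to move the support. *)
Definition side (b : bool) : 'I_5 := if b then o2 else o1.

(** The infinite recursion for directed elements descends along the spine of
    vertices [nseq n o0]; reading the labels makes it structural in v. *)
Fixpoint directed_label (s : nat -> bool) (a : alt5) (v : seq 'I_5) : alt5 :=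
  if v is i :: w then
    if i == o0 then directed_label (shift s) a w
    else if i == side (s 0) then rooted a w else 1
  else 1.

Definition directed s a : portrait := directed_label s a.

Implicit Type s : nat -> bool.

Lemma directedE s a : directed s a = node 1 (fun i =>
  if i == o0 then directed (shift s) a
  else if i == side (s 0) then rooted a else 1).
Proof. by apply: portraitP => // i; rewrite /section /=; do 2?case: eqP. Qed.

Lemma directedM s : {morph directed s : a b / a * b}.
Proof.
move=> a b; apply/funext=> v; elim: v s => [|i v IHv] s; first exact/esym/mulg1.
rewrite (directedE s (a * b)) (directedE s a) (directedE s b) node1M /=.
case: eqP => _; first exact: IHv.
by case: eqP => _; rewrite ?rootedM ?mulg1.
Qed.

Lemma directed1 s : directed s 1 = 1.
Proof. by apply: (mulIg (directed s 1)); rewrite -directedM !mul1g. Qed.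

Lemma directedV s : {morph directed s : a / a^-1}.
Proof.
by move=> a; apply: (mulIg (directed s a)); rewrite -directedM !mulVg directed1.
Qed.

Lemma directedR s a b : directed s [~ a, b] = [~ directed s a, directed s b].
Proof. by rewrite /commg /conjg !directedM !directedV. Qed.

(** This is used for elements c that move the support of the second factor so
    that it meets the support of the first one in at most one child. *)
Lemma directed_commg s a b c : 
  [~ directed s a, directed s b ^ rooted c] = node 1 (fun i =>
    [~ if i == o0 then directed (shift s) a
       else if i == side (s 0) then rooted a else 1,
       if i == move c o0 then directed (shift s) b
       else if i == move c (side (s 0)) then rooted b else 1]).
Proof.
rewrite (directedE s a) (directedE s b) node1J node1R; congr node.
apply/funext=> i.
by rewrite -!(can2_eq (moveKV c) (moveK c)).
Qed.

Lemma exists_fix0 k :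
  exists c : alt5, [/\ move c o0 = o0 & move c (side k) = o3].
Proof.
have [|c [c1 _ _ cE]] := @alt5_cycle3 (side k) o3 o4; first by case: k.
by exists c; rewrite c1 cE //; case: k {c1 cE}.
Qed.

Lemma exists_fix_side k :
  exists c : alt5, [/\ move c o0 = o3 & move c (side k) = side k].
Proof.
have [|c [c1 _ _ cE]] := @alt5_cycle3 o0 o3 o4; first by [].
by exists c; rewrite c1 cE //; case: k {c1 cE}.
Qed.

Lemma directed_commg0 s a b c : move c o0 = o0 -> move c (side (s 0)) = o3 ->
  [~ directed s a, directed s b ^ rooted c] =
    at_child o0 (directed (shift s) [~ a, b]).
Proof.
move=> c0 cp; rewrite directed_commg c0 cp directedR; congr node.
apply/funext=> i.
case: eqP => [//|_]; case: eqP => [->|_]; last by rewrite comm1g.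
by case: (s 0); rewrite /= commg1.
Qed.

Lemma directed_commg_side s a b c :
    move c o0 = o3 -> move c (side (s 0)) = side (s 0) ->
  [~ directed s a, directed s b ^ rooted c] =
    at_child (side (s 0)) (rooted [~ a, b]).
Proof.
move=> c0 cp; rewrite directed_commg c0 cp rootedR; congr node.
apply/funext=> i.
case: eqP => [->|_]; first by case: (s 0); rewrite /= commg1.
case: eqP => [->|_]; last by rewrite comm1g.
by case: (s 0).
Qed.

Lemma at_child_rooted i g a : at_child i g ^ rooted a = at_child (move a i) g.
Proof. by rewrite at_childJ conjg1. Qed.

(** Self-similarity, for a subgroup P of a product of two automorphism groups.
    With the graph of a map as P this compares two spinal groups whose
    parameters have a common first bit; with a P that looks at the first
    component only it finds the spinal group of [shift s] inside that of s. *)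
Lemma directed_descent s t (P : portrait * portrait -> Prop) :
    subgroup_pred P -> s 0 = t 0 -> (forall a, P (rooted a, rooted a)) ->
    (forall a, P (directed s a, directed t a)) ->
  (forall a, P (at_child o0 (rooted a), at_child o0 (rooted a))) /\
  (forall a, P (at_child o0 (directed (shift s) a),
                at_child o0 (directed (shift t) a))).
Proof.
move=> sgP st Pr Pd.
have PC a b c : P ([~ directed s a, directed s b ^ rooted c],
                   [~ directed t a, directed t b ^ rooted c]).
  by have := subgroup_predR sgP (Pd a) (subgroup_predJ sgP (Pd b) (Pr c)).
have sgPd (h : alt5 -> portrait * portrait) :
    h 1 = 1 -> {morph h : x y / x * y^-1} -> subgroup_pred (P \o h).
  move=> h1 hF; split=> /= [|x y Px Py].
    by rewrite h1; exact: subgroup_pred1.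
  by rewrite hF; case: sgP => _; apply.
split.
  apply: alt5_perfect => [|a b]; first apply: sgPd.
  - by rewrite rooted1 at_child1.
  - by move=> a b; rewrite rootedM rootedV at_childM at_childV.
  have [c [c0 cp]] := exists_fix_side (s 0).
  have [e ep] := alt5_transitive (side (s 0)) o0.
  have := subgroup_predJ sgP (PC a b c) (Pr e).
  rewrite -[_ ^ _]/(_ ^ _, _ ^ _) /=.
  rewrite !directed_commg_side -?st // !at_child_rooted.
  by rewrite -?st ep.
apply: alt5_perfect => [|a b]; first apply: sgPd.
- by rewrite !directed1 at_child1.
- by move=> a b; rewrite !directedM !directedV !at_childM !at_childV.
have [c [c0 cp]] := exists_fix0 (s 0).
by have := PC a b c; rewrite !directed_commg0 -?st.
Qed.

Inductive spinal s : portrait -> Prop :=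
| spinal_rooted a : spinal s (rooted a)
| spinal_directed a : spinal s (directed s a)
| spinal_one : spinal s 1
| spinal_div p q : spinal s p -> spinal s q -> spinal s (p * q^-1).

Lemma spinal_subgroup s : subgroup_pred (spinal s).
Proof. by split; [exact: spinal_one | exact: spinal_div]. Qed.

Lemma spinalM s p q : spinal s p -> spinal s q -> spinal s (p * q).
Proof. exact (@subgroup_predM _ _ (spinal_subgroup s) p q). Qed.

Lemma spinalV s p : spinal s p -> spinal s p^-1.
Proof. exact (@subgroup_predV _ _ (spinal_subgroup s) p). Qed.

Lemma spinalJ s p q : spinal s p -> spinal s q -> spinal s (p ^ q).
Proof. exact (@subgroup_predJ _ _ (spinal_subgroup s) p q). Qed.

Lemma spinal_ind_gen s (P : portrait -> Prop) : subgroup_pred P ->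
    (forall a, P (rooted a)) -> (forall a, P (directed s a)) ->
  forall p, spinal s p -> P p.
Proof.
by case=> P1 PF Pr Pd p; elim=> // {}p q _ Pp _; exact: PF.
Qed.

Lemma subgroup_at_child (P : portrait -> Prop) i :
  subgroup_pred P -> subgroup_pred (P \o at_child i).
Proof.
case=> P1 PF; split=> /= [|x y Px Py]; first by rewrite at_child1.
by rewrite at_childM at_childV; exact: PF.
Qed.

Lemma spinal_at_child s i g : spinal (shift s) g -> spinal s (at_child i g).
Proof.
move=> sg; suff sg0: spinal s (at_child o0 g).
  have [a <-] := alt5_transitive o0 i; rewrite -at_child_rooted.
  by apply: spinalJ => //; exact: spinal_rooted.
move: g sg; pose P (xy : portrait * portrait) := spinal s xy.1.
have sgP: subgroup_pred P.
  by split=> [|x y]; [exact: spinal_one | exact: spinal_div].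
have [r d] :=
  directed_descent sgP (erefl (s 0)) (spinal_rooted s) (spinal_directed s).
exact: (spinal_ind_gen (subgroup_at_child _ (spinal_subgroup s))).
Qed.

Lemma spinal_section s i p : spinal s p -> spinal (shift s) (section p i).
Proof.
move=> sp; elim: sp i => {p} [a|a||p q _ IHp _ IHq] i.
- exact: spinal_one.
- rewrite directedE section_node; case: eqP => _; first exact: spinal_directed.
  by case: eqP => _; [exact: spinal_rooted | exact: spinal_one].
- exact: spinal_one.
by rewrite sectionM sectionV; exact: spinal_div.
Qed.

(** Stated as a way to prove that a subgroup contains a spinal group. *)
Lemma spinal_perfect s (P : portrait -> Prop) : subgroup_pred P ->
    (forall g h, spinal s g -> spinal s h -> P [~ g, h]) ->
  forall p, spinal s p -> P p.
Proof.
move=> sgP PR; have [P1 PF] := sgP.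
apply: spinal_ind_gen => //.
  apply: alt5_perfect => [|a b]; last first.
    by rewrite rootedR; apply: PR; exact: spinal_rooted.
  by split=> [|a b Pa Pb]; rewrite ?rooted1 // rootedM rootedV; exact: PF.
apply: alt5_perfect => [|a b]; last first.
  by rewrite directedR; apply: PR; exact: spinal_directed.
by split=> [|a b Pa Pb]; rewrite ?directed1 // directedM directedV; exact: PF.
Qed.

(** [node 1 g] is the product of its five commuting parts. *)
Lemma subgroup_node1 (P : portrait -> Prop) (g : 'I_5 -> portrait) :
  subgroup_pred P -> (forall i, P (at_child i (g i))) -> P (node 1 g).
Proof.
move=> sgP Pg; pose gr (r : seq 'I_5) := fun i => if i \in r then g i else 1.
suff /(_ (enum 'I_5)): forall r, P (node 1 (gr r)).
  by congr (P (node _ _)); apply/funext=> i; rewrite /gr mem_enum.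
elim=> [|i r IHr]; first by rewrite /gr node1; exact: subgroup_pred1.
have [ir|nir] := boolP (i \in r).
  move: IHr; congr (P (node _ _)); apply/funext=> j.
  by rewrite /gr inE; case: eqP => [->|//]; rewrite ir.
have -> : node 1 (gr (i :: r)) = at_child i (g i) * node 1 (gr r).
  rewrite /at_child node1M; congr node; apply/funext=> j; rewrite /gr inE.
  by case: eqP => [->|_]; rewrite /= ?(negPf nir) ?mulg1 ?mul1g.
exact: subgroup_predM.
Qed.

Lemma spinal_node s a (g : 'I_5 -> portrait) :
  (forall i, spinal (shift s) (g i)) -> spinal s (node a g).
Proof.
move=> spinal_g; rewrite node_rooted; apply: spinalM.
  by apply: subgroup_node1 (spinal_subgroup s) _ => i; exact: spinal_at_child.
exact: spinal_rooted.
Qed.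

Lemma spinal_dense n s p :
  exists2 g, spinal s g & forall v, size v <= n -> g v = p v.
Proof.
elim: n s p => [|n IHn] s p.
  by exists (rooted (p [::])) => [|[]//]; exact: spinal_rooted.
have /choice[g gP] : forall i, exists g,
    spinal (shift s) g /\ forall v, size v <= n -> g v = section p i v.
  by move=> i; have [g gg gE] := IHn (shift s) (section p i); exists g.
exists (node (p [::]) g) => [|[|i v] //= /((gP i).2)//].
by apply: spinal_node => i; have [] := gP i.
Qed.

Fixpoint shiftn n s := if n is m.+1 then shiftn m (shift s) else s.

Lemma spinal_at_vertex w s g :
  spinal (shiftn (size w) s) g -> spinal s (at_vertex w g).
Proof.
by elim: w s => //= i w IHw s /IHw; exact: spinal_at_child.
Qed.

Lemma spinal_sections w s p :
  spinal s p -> spinal (shiftn (size w) s) (sections p w).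
Proof.
elim: w s p => //= i w IHw s p gp.
exact/(IHw _ (section p i))/spinal_section.
Qed.

Lemma spinal_transitive v w s :
  size v = size w -> exists2 p, spinal s p & act p v = w.
Proof.
elim: v w s => [|i v IHv] [|j w] s //=.
  by exists 1; first exact: spinal_one.
case=> /(IHv _ (shift s))[p gp pv]; have [a ai] := alt5_transitive i j.
exists (node a (fun=> p)) => /=; first exact: spinal_node.
by rewrite ai; congr (_ :: _).
Qed.

(** An element fixing the n-th level is the product, over the vertices of that
    level, of its sections, which lie in the spinal group of [shiftn n s]. *)
Lemma spinal_stabilizer n s (P : portrait -> Prop) : subgroup_pred P ->
    (forall w, size w = n ->
       forall g, spinal (shiftn n s) g -> P (at_vertex w g)) ->
  forall p, spinal s p -> (forall v, size v < n -> p v = 1) -> P p.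
Proof.
elim: n s P => [|n IHn] s P sgP Pat p gp p1; first exact: (Pat [::]).
rewrite (nodeE p) p1 //; apply: (subgroup_node1 sgP) => i.
apply: (IHn (shift s) (P \o at_child i)) => [||| v ltvn].
- exact: subgroup_at_child.
- by move=> w sw g gg; apply: (Pat (i :: w)); rewrite /= ?sw.
- exact: spinal_section.
by apply: p1.
Qed.

(** Every nontrivial normal subgroup contains a level stabilizer: below a vertex
    w moved by p the normal subgroup contains all commutators, hence by
    perfectness a full spinal group, and it is normalized by a level-transitive
    group. *)
Lemma spinal_normal_congruence s (P : portrait -> Prop) p :
    subgroup_pred P -> (forall x g, P x -> spinal s g -> P (x ^ g)) ->
    P p -> p <> 1 ->
  exists n, forall q, spinal s q -> (forall v, size v < n -> q v = 1) -> P q.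
Proof.
move=> sgP PJ Pp ntp.
have [w pw]: exists w, act p w != w.
  have [v pv]: exists v, p v <> 1.
    apply: contrapT => /forallNP p1; apply: ntp; apply/funext=> v.
    by apply: contrapT; exact: p1.
  by apply: (@act_moves p v); apply/eqP.
exists (size w); apply: spinal_stabilizer => // u su.
have PR x y : P x -> spinal s y -> P [~ x, y].
  move=> Px gy.
  exact (subgroup_predM sgP (subgroup_predV sgP Px) (PJ _ _ Px gy)).
have sg_at v : subgroup_pred (P \o at_vertex v).
  elim: v P sgP {Pp PJ PR} => [|i v IHv] Q sgQ; first exact: sgQ.
  exact: (IHv _ (subgroup_at_child i sgQ)).
(* P contains the full spinal group below w, by perfectness; *)
have Pw: forall g, spinal (shiftn (size w) s) g -> P (at_vertex w g).
  apply: (spinal_perfect (sg_at w)) => g h gg gh /=.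
  have gVg: spinal s (at_vertex w g^-1) by apply/spinal_at_vertex/spinalV.
  rewrite -(commg_moved g h pw); apply: (PR _ _); last exact: spinal_at_vertex.
  by rewrite -invgR; apply: (subgroup_predV sgP); exact: PR.
(* below any other vertex u of the level, conjugate by q moving w to u. *)
move=> g gg; have [q gq <-] := spinal_transitive s (esym su).
rewrite -(conjgKV (sections q w) g) -at_vertexJ.
apply: (PJ _ _ _ gq); apply: Pw.
by apply: spinalJ; [exact: gg | apply/spinalV/spinal_sections].
Qed.

(** * Reading the parameter off the marked group *)

Lemma alt5_nonabelian : exists a b : alt5, [~ a, b] <> 1.
Proof.
apply: contrapT => noab.
have [|a [a0 _ _ _]] := @alt5_cycle3 o0 o1 o2; first by [].
have a1: a = 1.
  apply: (@alt5_perfect (fun a => a = 1)) => [|x y].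
    by split=> [//|x y -> ->]; rewrite mulgV.
  by apply: contrapT => xy; apply: noab; exists x, y.
by move: a0; rewrite a1 move1.
Qed.

(** The rooted element c exchanges 0 with 3 and 1 with 4, and fixes 2. It moves
    the support of a directed element off itself if that support is {0, 1}, but
    not if it is {0, 2}. *)
Lemma directed_commg_detects :
  exists a b c, forall s,
    [~ directed s a, directed s b ^ rooted c] = 1 <-> s 0 = false.
Proof.
have [a [b ab]] := alt5_nonabelian.
have [|c [c0 _ c1 _ c2]] := @alt5_swaps o0 o3 o1 o4; first by [].
exists a, b, c => s; case s0: (s 0).
  split=> // /(congr1 (@^~ [:: o2])).
  by rewrite directed_commg_side ?s0 // c2.
split=> // _; rewrite directed_commg s0 c0 c1 -[RHS]node1; congr node.
apply/funext.
by apply: ord5_ind; rewrite /= ?commg1 ?comm1g.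
Qed.

(** Here P plays the role of the graph of an isomorphism that respects the
    generators. *)
Lemma marked_first_bit s t (P : portrait * portrait -> Prop) :
    subgroup_pred P -> (forall x y, P (x, y) -> x = 1 <-> y = 1) ->
    (forall a, P (rooted a, rooted a)) ->
    (forall a, P (directed s a, directed t a)) ->
  s 0 = t 0.
Proof.
move=> sgP P1 Pr Pd; have [a [b [c detects]]] := directed_commg_detects.
have PC := subgroup_predR sgP (Pd a) (subgroup_predJ sgP (Pd b) (Pr c)).
have [st ts] := P1 _ _ PC.
case s0: (s 0); case t0: (t 0) => //.
  by have /detects := ts (proj2 (detects t) t0); rewrite s0.
by have /detects := st (proj2 (detects s) s0); rewrite t0.
Qed.

(** Descending to the child o0 repeatedly makes every bit of s and t the first
    bit of some marked pair, where a relator detects it. *)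
Lemma marked_rigid s t (P : portrait * portrait -> Prop) :
    subgroup_pred P -> (forall x y, P (x, y) -> x = 1 <-> y = 1) ->
    (forall a, P (rooted a, rooted a)) ->
    (forall a, P (directed s a, directed t a)) ->
  s = t.
Proof.
move=> sgP P1 Pr Pd; apply/funext=> n.
elim: n s t P sgP P1 Pr Pd => [|n IHn] s t P sgP P1 Pr Pd.
  exact: marked_first_bit sgP P1 Pr Pd.
have st := marked_first_bit sgP P1 Pr Pd.
have [Pr0 Pd0] := directed_descent sgP st Pr Pd.
pose P0 u := P (at_child o0 u.1, at_child o0 u.2).
apply: (IHn (shift s) (shift t) P0) => //.
  split=> [|x y Px Py]; first by rewrite /P0 at_child1; case: sgP.
  by rewrite /P0 !at_childM !at_childV; exact: (proj2 sgP _ _ Px Py).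
have at_child_eq1 g : at_child o0 g = 1 <-> g = 1.
  by split=> [/(congr1 (section^~ o0))|->]; rewrite ?at_child1.
by move=> x y /P1; rewrite !at_child_eq1.
Qed.

Definition spinal_pred s : {pred portrait} := fun p => `[< spinal s p >].

Lemma spinal_pred_closed s : group_closed (spinal_pred s).
Proof.
split=> [|p q]; first by apply/asboolP; exact: spinal_one.
by move=> /asboolP gp /asboolP gq; apply/asboolP; exact: spinal_div.
Qed.

Definition spinalType s := {p : portrait | p \in spinal_pred s}.

HB.instance Definition _ s := SubChoice.on (spinalType s).
HB.instance Definition _ s :=
  SubChoice_isSubGroup.Build portrait (spinal_pred s) (spinalType s)
    (spinal_pred_closed s).

Lemma spinal_val s (x : spinalType s) : spinal s (val x).
Proof. exact/asboolP/(valP x). Qed.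

Definition spinal_mk s p (gp : spinal s p) : spinalType s := Sub p (asboolT gp).

Definition rooted_elt s a : spinalType s := spinal_mk (spinal_rooted s a).
Definition directed_elt s a : spinalType s := spinal_mk (spinal_directed s a).

Lemma spinalType_ind s (P : spinalType s -> Prop) : subgroup_pred P ->
    (forall a, P (rooted_elt s a)) -> (forall a, P (directed_elt s a)) ->
  forall x, P x.
Proof.
move=> [P1 PF] Pr Pd x.
suff: forall p, spinal s p -> exists2 y, val y = p & P y.
  by move=> /(_ _ (spinal_val x))[y /val_inj->].
apply: spinal_ind_gen => [|a|a].
- split=> [|_ _ [x1 <- Px1] [y1 <- Py1]]; first by exists 1; rewrite ?val1.
  by exists (x1 * y1^-1); [rewrite gmulfF | exact: PF].
- by exists (rooted_elt s a); rewrite ?SubK.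
by exists (directed_elt s a); rewrite ?SubK.
Qed.

End SpinalGroups.

(** * Profinite completion as the limit of a sequence *)

Local Open Scope quotient_scope.

Section Kernel.
Variables (G : groupType) (Q : finGroupType) (f : group_hom G Q).

Definition kernel_pred : {pred G} := fun x => f x == 1.

Lemma kernel_closed : group_closed kernel_pred.
Proof.
split=> [|x y]; first by rewrite unfold_in gmulf1.
by rewrite !unfold_in => /eqP fx /eqP fy; rewrite gmulfF fx fy mulgV.
Qed.

Lemma kernel_normal x g : x \in kernel_pred -> x ^ g \in kernel_pred.
Proof. by rewrite !unfold_in => /eqP fx; rewrite gmulfJ fx conj1g. Qed.

Definition kernel := NormalSubgroup kernel_closed kernel_normal.

Lemma mem_kernel x : (x \in kernel) = (f x == 1). Proof. by []. Qed.

Lemma kernelP x y : x^-1 * y \in kernel <-> f x = f y.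
Proof.
rewrite mem_kernel gmulfM gmulfV; split=> [/eqP/(congr1 ( *%g (f x)))|->].
  by rewrite mulVKg mulg1.
by rewrite mulVg.
Qed.

Lemma kernel_finite_index : finite_index kernel.
Proof.
pose h (a : quot kernel) : Q := f (repr a).
have injh : {in (h @^-1` setT)%classic &, injective h}.
  move=> a b _ _ hab; rewrite -[a]reprK -[b]reprK; exact/quot_eqP/kernelP.
rewrite /finite_index -(preimage_setT h).
by apply: finite_preimage injh _; exact: finite_finset.
Qed.

End Kernel.

(** If finite quotients [phi n] of G are cofinal among all its finite quotients,
    then the completion is already the limit of the sequence of these. *)
Section Completion.
Variables (Q : nat -> finGroupType) (proj : forall n, group_hom (Q n.+1) (Q n)).

Definition sequence_system : group_system := {|
  gs_index := nat;
  gs_group := Q;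
  gs_arrow := nat;
  gs_src := succn;
  gs_tgt := id;
  gs_map := proj
|}.

Variables (G : groupType) (phi : forall n, group_hom G (Q n)).
Hypothesis phi_proj : forall n x, proj n (phi n.+1 x) = phi n x.
Hypothesis phi_surj : forall n y, exists x, phi n x = y.
Hypothesis phi_cofinal : forall N : normal_subgroup G, finite_index N ->
  exists n, {subset kernel (phi n) <= N}.

Lemma phi_thread (y : limit sequence_system) m n x : (m <= n)%N ->
  phi n x = limit_coord y n -> phi m x = limit_coord y m.
Proof.
move=> /subnK<-; elim: (n - m)%N => // k IHk /(congr1 (proj _)) e; apply: IHk.
by rewrite -phi_proj e; exact: (limit_coordP y).
Qed.

Definition completion_index := {N : normal_subgroup G | finite_index N}.

Definition kernel_index n : completion_index :=
  exist _ (kernel (phi n)) (kernel_finite_index (phi n)).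

Lemma limit_coord_arrow (x : profinite_completion G) (N M : completion_index)
    (sNM : {subset sval N <= sval M}) :
  limit_coord x M = quot_map sNM (limit_coord x N).
Proof. exact/esym/(limit_coordP x (exist _ (N, M) sNM)). Qed.

Definition to_limit_coord (x : profinite_completion G) n : Q n :=
  phi n (repr (limit_coord x (kernel_index n))).

Lemma phi_repr n g : phi n (repr (\pi_(quot (kernel (phi n))) g)) = phi n g.
Proof. exact/esym/kernelP/quot_repr. Qed.

Lemma to_limit_subproof x n :
  proj n (to_limit_coord x n.+1) = to_limit_coord x n.
Proof.
have sK: {subset sval (kernel_index n.+1) <= sval (kernel_index n)}.
  by move=> g; rewrite !mem_kernel -(phi_proj n) => /eqP->; rewrite gmulf1.
rewrite phi_proj /to_limit_coord (limit_coord_arrow x sK).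
by rewrite -{2}[limit_coord x _]reprK quot_mapE phi_repr.
Qed.

Definition to_limit x : limit sequence_system :=
  limit_mk (S := sequence_system) (to_limit_subproof x).

Lemma to_limitM : {morph to_limit : x y / x * y}.
Proof.
move=> x y; apply: limit_inj => n.
rewrite -[LHS]/(phi n (repr (limit_coord x (kernel_index n) *
                             limit_coord y (kernel_index n)))).
rewrite -[limit_coord x _]reprK -[limit_coord y _]reprK -gmulfM phi_repr gmulfM.
by [].
Qed.

HB.instance Definition _ := isGroupMorphism.Build _ _ to_limit
  (morph_mulg_divg to_limitM).

(** The inverse map sends a thread y to the coset of any element of G that
    agrees with y at a stage whose kernel is contained in N; by
    [of_limit_coordE] the stage and the element do not matter. *)
Definition cofinal_level (N : completion_index) : nat :=
  sval (cid (phi_cofinal (svalP N))).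

Lemma cofinal_level_sub N : {subset kernel (phi (cofinal_level N)) <= sval N}.
Proof. exact: (svalP (cid (phi_cofinal (svalP N)))). Qed.

Definition lift_elt n (y : Q n) : G := sval (cid (phi_surj y)).

Lemma lift_eltK n (y : Q n) : phi n (lift_elt y) = y.
Proof. exact: (svalP (cid (phi_surj y))). Qed.

Definition of_limit_coord (y : limit sequence_system) (N : completion_index) :
    quot (sval N) :=
  \pi_(quot (sval N)) (lift_elt (limit_coord y (cofinal_level N))).

Lemma of_limit_coordE (y : limit sequence_system) (N : completion_index)
    n g : {subset kernel (phi n) <= sval N} ->
  phi n g = limit_coord y n -> of_limit_coord y N = \pi_(quot (sval N)) g.
Proof.
move=> sKN gn; set l := cofinal_level N.
set z := lift_elt (limit_coord y (maxn l n)).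
have zP: phi (maxn l n) z = limit_coord y (maxn l n) by exact: lift_eltK.
transitivity (\pi_(quot (sval N)) z).
  apply/quot_eqP/(@cofinal_level_sub N)/kernelP; rewrite lift_eltK.
  exact/esym/(phi_thread (leq_maxl _ _) zP).
apply/quot_eqP/sKN/kernelP; rewrite gn; exact: phi_thread (leq_maxr _ _) zP.
Qed.

Lemma of_limit_subproof y (a : gs_arrow (completion_system G)) :
  gs_map a (of_limit_coord y (gs_src a)) = of_limit_coord y (gs_tgt a).
Proof.
case: a => -[N M] sNM /=; rewrite quot_mapE.
apply/esym/(@of_limit_coordE y M (cofinal_level N)); last exact: lift_eltK.
by move=> g /cofinal_level_sub/sNM.
Qed.

Definition of_limit y : profinite_completion G :=
  limit_mk (S := completion_system G) (of_limit_subproof y).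

Lemma to_limitK : cancel to_limit of_limit.
Proof.
move=> x; apply: limit_inj => N; rewrite -[LHS]/(of_limit_coord _ N).
set n := cofinal_level N; set xn := limit_coord x (kernel_index n).
rewrite (@of_limit_coordE _ _ _ (repr xn) (@cofinal_level_sub N)) //.
by rewrite (@limit_coord_arrow x (kernel_index n) N (@cofinal_level_sub N)).
Qed.

Lemma of_limitK : cancel of_limit to_limit.
Proof.
move=> y; apply: limit_inj => n.
rewrite -[LHS]/(phi n (repr (of_limit_coord y (kernel_index n)))).
by rewrite (@of_limit_coordE _ _ n (lift_elt (limit_coord y n))) ?phi_repr
  ?lift_eltK.
Qed.

Lemma nbhs_limit_coord (S : group_system) (x : limit S) i :
  nbhs x [set z | limit_coord z i = limit_coord x i]%classic.
Proof. exact: (limit_coord_continuous (discrete_set1 _)). Qed.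

Lemma limit_locally_constant (S T : group_system) (f : limit S -> limit T) :
    (forall j, exists i, forall x y, limit_coord x i = limit_coord y i ->
       limit_coord (f x) j = limit_coord (f y) j) ->
  continuous f.
Proof.
move=> fP; apply: limit_continuous => j x U /nbhs_singleton /= Ux.
have [i iP] := fP j; apply: filterS (nbhs_limit_coord x i) => z /= /iP e.
by rewrite /= e.
Qed.

Theorem profinite_completion_sequence :
  topGroup_isomorphic (profinite_completion G) (limit sequence_system).
Proof.
exists to_limit, of_limit; split; [exact: to_limitK | exact: of_limitK | |].
  apply: limit_locally_constant => n; exists (kernel_index n) => x y e.
  by rewrite -[LHS]/(to_limit_coord x n) /to_limit_coord e.
apply: limit_locally_constant => N; exists (cofinal_level N) => x y e.
by rewrite -[LHS]/(of_limit_coord x N) /of_limit_coord e.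
Qed.

End Completion.

(** * The action on the levels of the tree *)

Section Levels.

Implicit Types (p q : portrait) (v : seq 'I_5).

(** In [tree_level] the newest letter comes last, in a portrait the letters are
    read from the root. *)
Fixpoint vertex n : tree_level n -> seq 'I_5 :=
  match n with
  | 0 => fun i => [:: i]
  | m.+1 => fun x => rcons (vertex x.1) x.2
  end.

Lemma size_vertex n (x : tree_level n) : size (vertex x) = n.+1.
Proof. by elim: n x => //= n IHn x; rewrite size_rcons IHn. Qed.

Lemma vertex_inj n : injective (@vertex n).
Proof.
elim: n => [x y []//|n IHn] [x i] [y j] /= /rcons_inj[/IHn-> ->].
by [].
Qed.

Lemma vertex_surj n v : size v = n.+1 -> exists x : tree_level n, vertex x = v.
Proof.
elim: n v => [|n IHn] v; first by case: v => [|i []] // _; exists i.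
case/lastP: v => // v i; rewrite size_rcons => -[/IHn[x <-]].
by exists (x, i).
Qed.

Fixpoint level_perm n p : {perm tree_level n} :=
  match n with
  | 0 => sgval (p [::])
  | m.+1 => wr_perm [ffun x : tree_level m => sgval (p (vertex x))]
                    (level_perm m p)
  end.

Lemma level_perm_in n p : level_perm n p \in W_ n.
Proof.
elim: n => [|n IHn] /=; first exact: subgP.
by apply: mem_wr_perm => // x; rewrite ffunE subgP.
Qed.

Lemma vertex_level_perm n p (x : tree_level n) :
  vertex (level_perm n p x) = act p (vertex x).
Proof.
elim: n x => [//|n IHn] [x i] /=.
by rewrite wr_permE /= IHn act_rcons ffunE.
Qed.

Lemma level_permM n p q :
  level_perm n (p * q) = level_perm n p * level_perm n q.
Proof.
elim: n => [|n IHn] /=; first exact: sgvalM.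
rewrite wr_permM IHn; congr wr_perm; apply/ffunP=> x.
by rewrite !ffunE portrait_mulE vertex_level_perm sgvalM.
Qed.

Lemma wr_perm_inj (X Y : finType) (y : Y) (f g : {ffun X -> {perm Y}})
    (a b : {perm X}) :
  wr_perm f a = wr_perm g b -> f = g /\ a = b.
Proof.
move=> /permP e; split; last first.
  by apply/permP=> x; have := e (x, y); rewrite !wr_permE => -[].
by apply/ffunP=> x; apply/permP=> z; have := e (x, z); rewrite !wr_permE => -[].
Qed.

Lemma level_permP n p q :
  level_perm n p = level_perm n q <-> forall v, size v <= n -> p v = q v.
Proof.
elim: n => [|n IHn] /=.
  by split=> [/val_inj e []//|->].
split=> [/(wr_perm_inj o0)[/ffunP ef /IHn es] v|e].
  rewrite leq_eqVlt => /predU1P[/vertex_surj[x <-]|]; last exact: es.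
  by have := ef x; rewrite !ffunE => /val_inj.
congr wr_perm; last by apply/IHn => v lev; apply: e; exact: leqW.
by apply/ffunP=> x; rewrite !ffunE e ?size_vertex.
Qed.

(** The new labels are written at the words of length [n.+1], which the labels
    of p are not responsible for. *)
Lemma level_perm_surj n y : y \in W_ n -> exists p, level_perm n p = y.
Proof.
elim: n y => [|n IHn] y.
  by move=> Wy; exists (fun=> subg _ y); rewrite /= subgK.
case/wreathP=> f [t [Af /IHn[p pt] ->]].
pose q : portrait := fun v =>
  if [pick x : tree_level n | vertex x == v] is Some x
  then subg A5 (f x) else p v.
exists q => /=; congr wr_perm; last first.
  rewrite -pt; apply/level_permP => v lev; rewrite /q.
  by case: pickP => // x /eqP wx; move: lev; rewrite -wx size_vertex ltnn.
apply/ffunP=> x; rewrite ffunE /q; case: pickP => [z /eqP/vertex_inj->|/(_ x)].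
  by rewrite subgK ?Af.
by rewrite eqxx.
Qed.

End Levels.

Section SpinalLevel.
Variable s : nat -> bool.

Definition spinal_level n (x : spinalType s) : subg_of (W_ n) :=
  subg (W_ n) (level_perm n (val x)).

Lemma spinal_levelM n : {morph @spinal_level n : x y / x * y}.
Proof.
move=> x y; apply: val_inj.
rewrite [RHS]sgvalM ?inE // !subgK ?level_perm_in // -level_permM.
by rewrite -gmulfM.
Qed.

HB.instance Definition _ n := isGroupMorphism.Build _ _ (@spinal_level n)
  (morph_mulg_divg (@spinal_levelM n)).

Lemma spinal_levelP n x y :
  spinal_level n x = spinal_level n y <->
  forall v, size v <= n -> val x v = val y v.
Proof.
split=> [/(congr1 sgval)|/level_permP e]; last by rewrite /spinal_level e.
by rewrite !subgK ?level_perm_in // => /level_permP.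
Qed.

Lemma spinal_level_surj n y : exists x, spinal_level n x = y.
Proof.
have [p py] := level_perm_surj (subgP y).
have [g gg ge] := spinal_dense n s p.
exists (spinal_mk gg); apply: val_inj; rewrite subgK ?level_perm_in //.
by apply: etrans py; exact/level_permP.
Qed.

Lemma W_proj_spinal_level n x : W_proj (spinal_level n.+1 x) = spinal_level n x.
Proof.
rewrite /W_proj /wr_projg /spinal_level subgK; first by rewrite (wr_projK o0).
exact: (level_perm_in n.+1).
Qed.

Lemma spinal_residually_finite : residually_finite (spinalType s).
Proof.
move=> x ntx; have [v xv]: exists v, val x v <> 1.
  apply: contrapT => /forallNP x1; apply/ntx/val_inj/funext=> v.
  by apply: contrapT; exact: x1.
exists (kernel (@spinal_level (size v))); first exact: kernel_finite_index.
rewrite mem_kernel -(@gmulf1 _ _ (@spinal_level (size v))).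
by apply/eqP=> /spinal_levelP/(_ v (leqnn _)).
Qed.

Lemma at_rooted_inj (a : alt5) k l : a <> 1 ->
  at_vertex (nseq k o0) (rooted a) = at_vertex (nseq l o0) (rooted a) -> k = l.
Proof.
move=> nta; elim: k l => [|k IHk] [|l] //=.
3: move=> e; congr _.+1; apply: IHk.
- by move/(congr1 (@^~ [::])).
- by move/(congr1 (@^~ [::])) => /esym.
by have := congr1 (section^~ o0) e.
Qed.

Lemma spinal_infinite : exists h : nat -> spinalType s, injective h.
Proof.
have [a [b ab]] := alt5_nonabelian.
have gh k : spinal s (at_vertex (nseq k o0) (rooted [~ a, b])).
  by apply: spinal_at_vertex; exact: spinal_rooted.
by exists (fun k => spinal_mk (gh k)) => k l /(congr1 val)/(at_rooted_inj ab).
Qed.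

(** Otherwise the infinite spinal group would embed into a finite quotient. *)
Lemma finite_index_nontrivial (N : normal_subgroup (spinalType s)) :
  finite_index N -> exists2 x, x \in N & x <> 1.
Proof.
move=> finN; apply: contrapT => N1; have [h injh] := spinal_infinite.
pose f k : quot N := \pi_(quot N) (h k).
have injf: injective f.
  move=> k l /quot_eqP Nkl; apply: injh; apply: contrapT => hkl; apply: N1.
  exists ((h k)^-1 * h l) => // /eqP; rewrite mulg_eq1 => /eqP/invg_inj.
  exact: hkl.
apply: infinite_nat; rewrite -(preimage_setT f).
by apply: finite_preimage finN => k l _ _; exact: injf.
Qed.

Lemma spinal_congruence (N : normal_subgroup (spinalType s)) : finite_index N ->
  exists n, {subset kernel (@spinal_level n) <= N}.
Proof.
move=> /finite_index_nontrivial[x Nx ntx].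
pose P p := exists2 y, y \in N & val y = p.
have [||||n nP] := @spinal_normal_congruence s P (val x).
- split=> [|_ _ [y Ny <-] [z Nz <-]]; first by exists 1; rewrite ?nsub1 ?val1.
  exists (y * z^-1); last by rewrite gmulfF.
  exact/nsubM/nsubV.
- move=> _ g [y Ny <-] gg; exists (y ^ spinal_mk gg); first exact: nsub_normal.
  by rewrite gmulfJ.
- by exists x.
- by move=> x1; apply/ntx/val_inj; rewrite x1 val1.
exists n => y; rewrite mem_kernel -(@gmulf1 _ _ (@spinal_level n)).
move=> /eqP/spinal_levelP y1.
have [z Nz /val_inj<-//] := nP _ (spinal_val y) (fun v lt => y1 v (ltnW lt)).
Qed.

Lemma spinal_completion :
  topGroup_isomorphic (profinite_completion (spinalType s)) W.
Proof.
exact: (@profinite_completion_sequence (fun n => subg_of (W_ n))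
  (fun n => @W_proj n) (spinalType s) (fun n => @spinal_level n)
  W_proj_spinal_level spinal_level_surj spinal_congruence).
Qed.

End SpinalLevel.

(** * Non-isomorphic groups from rigid markings *)

Implicit Type s : nat -> bool.

(** Split y into countably many rows. If for every n some sequence [d n] were
    missed by the n-th rows of the fiber of k over n, then the y with rows [d n]
    would be in no fiber. So for some n all sequences are n-th rows in the fiber
    over n, and a section of this surjection is the required c. *)
Lemma cantor_constant_fiber (k : (nat -> bool) -> nat) :
  exists c : (nat -> bool) -> (nat -> bool),
    injective c /\ exists n, forall x, k (c x) = n.
Proof.
pose row (n : nat) (y : nat -> bool) (m : nat) : bool := y (pickle (n, m)).
have [n nP]: exists n, forall x, exists y, k y = n /\ row n y = x.
  apply: contrapT => /forallNP noP.
  have /choice[d dP] : forall n, exists x, forall y, k y = n -> row n y <> x.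
    move=> n; have /existsNP[x xP] := noP n.
    by exists x => y ky ry; apply: xP; exists y.
  pose y (l : nat) := if unpickle l is Some (n, m) then d n m else false.
  by apply: (dP _ y erefl); apply/funext=> m; rewrite /row /y pickleK.
have /choice[c cP] := nP; exists c; split; last by exists n => x; case: (cP x).
by move=> x y cxy; rewrite -(proj2 (cP x)) -(proj2 (cP y)) cxy.
Qed.

Lemma group_isomorphic_refl (G : groupType) : group_isomorphic G G.
Proof. by exists idfun; exists id. Qed.

Lemma group_isomorphic_sym (G H : groupType) :
  group_isomorphic G H -> group_isomorphic H G.
Proof.
case=> f [g fK gK].
have gF := morph_mulg_divg (can2_gmulfM fK gK).
pose g' : group_hom H G := HB.pack g (isGroupMorphism.Build H G g gF).
by exists g'; exists f.
Qed.

Lemma group_isomorphic_trans (G H K : groupType) :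
  group_isomorphic G H -> group_isomorphic H K -> group_isomorphic G K.
Proof. by case=> f bijf [g bijg]; exists (g \o f); exact: bij_comp. Qed.

Section Marked.
Variables (k : nat) (G : (nat -> bool) -> groupType).
Variable a : forall s, 'I_k -> G s.

Definition generates s :=
  forall P : G s -> Prop, subgroup_pred P ->
    (forall i, P (a s i)) -> forall x, P x.

Definition eval s (w : seq ('I_k * bool)) : G s :=
  foldr (fun l x => (if l.2 then a s l.1 else (a s l.1)^-1) * x) 1 w.

Lemma eval_cat s w1 w2 : eval s (w1 ++ w2) = eval s w1 * eval s w2.
Proof. by elim: w1 => [|l w1 IHw] /=; rewrite ?mul1g // IHw mulgA. Qed.

Lemma evalV s w : exists w', eval s w' = (eval s w)^-1.
Proof.
elim: w => [|[i b] w [w' ew']]; first by exists [::]; rewrite /= invg1.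
exists (w' ++ [:: (i, ~~ b)]); rewrite eval_cat ew' /= mulg1 invgM.
by case: b; rewrite ?invgK.
Qed.

Lemma eval_surj s : generates s -> forall x, exists w, eval s w = x.
Proof.
apply; last by move=> i; exists [:: (i, true)]; rewrite /= mulg1.
split=> [|_ _ [w1 <-] [w2 <-]]; first by exists [::].
by have [w' <-] := evalV s w2; exists (w1 ++ w'); rewrite eval_cat.
Qed.

Hypothesis gen_a : forall s, generates s.
Hypothesis rigid_a : forall s t (H : groupType) (f : group_hom (G s) H)
    (g : group_hom (G t) H), injective f -> injective g ->
  (forall i, f (a s i) = g (a t i)) -> s = t.

(** Isomorphisms to a representative [r s] of the class carry the marking of G s
    to a k-tuple of words [m s]. By rigidity this countable invariant separates
    the parameters of a class; restrict to parameters where it is constant. *)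
Lemma rigid_selection : exists c : (nat -> bool) -> (nat -> bool),
  forall s t, group_isomorphic (G (c s)) (G (c t)) -> s = t.
Proof.
pose class s := [set t | group_isomorphic (G s) (G t)]%classic.
pose r s := xget (fun=> false) (class s).
have rP s : group_isomorphic (G s) (G (r s)).
  by apply: (@xgetPex _ _ (class s)); exists s; exact: group_isomorphic_refl.
have r_eq s t : group_isomorphic (G s) (G t) -> r s = r t.
  move=> st; congr xget; apply/seteqP.
  split=> u /=; apply: group_isomorphic_trans => //.
  exact: group_isomorphic_sym.
have /choice[m mP] : forall s, exists m : {ffun 'I_k -> seq ('I_k * bool)},
    exists2 f : group_hom (G s) (G (r s)), injective f &
      forall i, f (a s i) = eval (r s) (m i).
  move=> s; have [f /bij_inj injf] := rP s.
  have /choice[w wP] : forall i, exists w, eval (r s) w = f (a s i).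
    by move=> i; exact: eval_surj.
  by exists (finfun w); exists f => // i; rewrite ffunE wP.
have [c [injc [n cn]]] := cantor_constant_fiber (pickle \o m).
exists c => s t /r_eq rst; apply: injc.
have mst: m (c s) = m (c t).
  by apply: (pcan_inj pickleK); exact: etrans (cn s) (esym (cn t)).
have [f injf fE] := mP (c s); have [g injg gE] := mP (c t).
move: f injf fE; rewrite rst mst => f injf fE.
by apply: rigid_a injf injg _ => i; rewrite fE gE.
Qed.

End Marked.

(** Alt(5) being generated by x and y, the four elements given by x and y among
    the rooted and the directed ones generate, and a homomorphism is determined
    on all rooted and directed elements by its values there. *)
Lemma spinal_marking : exists a : forall s, 'I_4 -> spinalType s,
  (forall s, @generates 4 spinalType a s) /\
  (forall s t (H : groupType) (f : group_hom (spinalType s) H)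
      (g : group_hom (spinalType t) H),
     injective f -> injective g -> (forall i, f (a s i) = g (a t i)) -> s = t).
Proof.
have [x [y xyP]] := alt5_gen2.
exists (fun s i => nth 1 [:: rooted_elt s x; rooted_elt s y;
                             directed_elt s x; directed_elt s y] i).
have rootedF s : {morph rooted_elt s : a b / a * b^-1}.
  by move=> a b; apply: val_inj; rewrite gmulfF /= rootedM rootedV.
have directedF s : {morph directed_elt s : a b / a * b^-1}.
  by move=> a b; apply: val_inj; rewrite gmulfF /= directedM directedV.
have rooted_elt1 s : rooted_elt s 1 = 1.
  by apply: val_inj; rewrite gmulf1 /= rooted1.
have directed_elt1 s : directed_elt s 1 = 1.
  by apply: val_inj; rewrite gmulf1 /= directed1.
split=> [s P sgP Pa|s t H f g injf injg fg].
  have [P1 PF] := sgP.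
  apply: spinalType_ind => //; apply: xyP.
  - by split=> [|a b]; rewrite ?rooted_elt1 ?rootedF //; exact: PF.
  - exact: (Pa (@Ordinal 4 0 isT)).
  - exact: (Pa (@Ordinal 4 1 isT)).
  - by split=> [|a b]; rewrite ?directed_elt1 ?directedF //; exact: PF.
  - exact: (Pa (@Ordinal 4 2 isT)).
  exact: (Pa (@Ordinal 4 3 isT)).
pose P (u : portrait * portrait) :=
  exists z z', [/\ val z = u.1, val z' = u.2 & f z = g z'].
have sgfg (h : forall s, alt5 -> spinalType s) : (forall s, h s 1 = 1) ->
    (forall s, {morph h s : a b / a * b^-1}) ->
    subgroup_pred (fun a => f (h s a) = g (h t a)).
  move=> h1 hF; split=> [|a b ea eb]; first by rewrite !h1 !gmulf1.
  by rewrite !hF !gmulfF ea eb.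
apply: (@marked_rigid s t P).
- split=> [|[p p'] [q q'] [z [z' /= [<- <- e]]] [w [w' /= [<- <- e']]]].
    by exists 1, 1; rewrite !gmulf1.
  by exists (z * w^-1), (z' * w'^-1); rewrite !gmulfF e e'.
- move=> _ _ [z [z' /= [<- <- e]]].
  split=> [z1|z1].
    have {}z1: z = 1 by apply: val_inj; rewrite gmulf1; exact: z1.
    by move: e; rewrite z1 gmulf1 -(@gmulf1 _ _ g) => /injg <-.
  have {}z1: z' = 1 by apply: val_inj; rewrite gmulf1; exact: z1.
  by move: e; rewrite z1 gmulf1 -(@gmulf1 _ _ f) => /injf ->.
- move=> a; exists (rooted_elt s a), (rooted_elt t a); split=> //.
  apply: (xyP _ (sgfg _ rooted_elt1 rootedF)).
    exact: (fg (@Ordinal 4 0 isT)).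
  exact: (fg (@Ordinal 4 1 isT)).
move=> a; exists (directed_elt s a), (directed_elt t a); split=> //.
apply: (xyP _ (sgfg _ directed_elt1 directedF)).
  exact: (fg (@Ordinal 4 2 isT)).
exact: (fg (@Ordinal 4 3 isT)).
Qed.

Theorem theorem6 :
  exists Gamma : (nat -> bool) -> groupType,
    (forall s, [/\ n_generator 4 (Gamma s),
                   residually_finite (Gamma s)
                 & topGroup_isomorphic (profinite_completion (Gamma s)) W]) /\
    (forall s t, group_isomorphic (Gamma s) (Gamma t) -> s = t).
Proof.
have [a [gen_a rigid_a]] := spinal_marking.
have [c cP] := rigid_selection gen_a rigid_a.
exists (fun s => spinalType (c s)); split=> // s; split.
- exists (a (c s)) => H HG Ha; exact: gen_a.
- exact: spinal_residually_finite.
exact: spinal_completion.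
Qed.
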